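(* Let $(G,i)$ be a rooted graph such that $i$ is not an isolated vertex of $G$. Then $(G,i)$ allows the nullity pair $(0,1)$ with the SNIP.
   Context: All matrices are real. For a simple graph $G$ on $[n]$, $\mathcal{S}(G)$ is the set of real symmetric $n\times n$ matrices whose off-diagonal $(j,k)$ entry is nonzero iff $\{j,k\}\in E(G)$ (diagonal free). $A(i)$ is $A$ with row and column $i$ deleted. $A$ has the $i$-SNIP if $X=O$ is the only real symmetric $X$ with $A\circ X=O$, $I\circ X=O$ and $(AX)(i,:]=O$ ($AX$ with row $i$ deleted). A rooted graph $(G,i)$ allows $(k,\ell)$ with the SNIP if some $A\in\mathcal{S}(G)$ with the $i$-SNIP has $(\operatorname{null}(A),\operatorname{null}(A(i)))=(k,\ell)$. *)

(* Defs.v *)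
From mathcomp Require Import all_boot all_order all_algebra.
From mathcomp Require Import reals.

Set Implicit Arguments.
Unset Strict Implicit.
Unset Printing Implicit Defensive.

Import GRing.Theory.
Local Open Scope ring_scope.

Record simple_graph (n : nat) := SimpleGraph {
  adj :> rel 'I_n;
  adj_sym : symmetric adj;
  adj_irr : irreflexive adj }.

Definition isolated (n : nat) (G : simple_graph n) (i : 'I_n) : Prop :=
  forall j : 'I_n, ~~ G i j.

Definition in_S (R : realType) (n : nat) (G : simple_graph n)
    (A : 'M[R]_n) : Prop :=
  A^T = A /\ forall j k : 'I_n, j != k -> (A j k != 0 <-> G j k).

Definition hadamard (R : realType) (m n : nat) (A B : 'M[R]_(m, n)) :
    'M[R]_(m, n) :=
  map2_mx *%R A B.

Definition principal_del (R : realType) (n : nat) (A : 'M[R]_n) (i : 'I_n) :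
    'M[R]_n.-1 :=
  row' i (col' i A).

(* The columns of [cokermx A] span the null space {v | A *m v = 0}. *)
Definition nullity (R : realType) (m n : nat) (A : 'M[R]_(m, n)) : nat :=
  \rank (cokermx A).

Definition SNIP (R : realType) (n : nat) (i : 'I_n) (A : 'M[R]_n) : Prop :=
  forall X : 'M[R]_n,
    X^T = X ->
    hadamard A X = 0 ->
    hadamard 1%:M X = 0 ->
    row' i (A *m X) = 0 ->
    X = 0.

Definition allows_with_SNIP (R : realType) (n : nat) (G : simple_graph n)
    (i : 'I_n) (k l : nat) : Prop :=
  exists A : 'M[R]_n,
    [/\ in_S G A, SNIP i A & (nullity A, nullity (principal_del A i)) = (k, l)].

(* Main.v *)
Require Import Defs.
From mathcomp Require Import all_boot all_order all_algebra.
From mathcomp Require Import reals.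
From mathcomp Require Import ring.

(** Every invertible matrix has the [i]-SNIP: if all rows of [A X] but the
    [i]-th vanish, then [X] is the outer product of [A^-1 e_i] with some row,
    and a symmetric outer product with zero diagonal is zero. It therefore
    suffices to find an invertible [A] in S(G) whose inverse has [(i, i)] entry
    zero; then [A(i)] is singular, of nullity one since deleting a row and a
    column lowers the rank by at most two.

    Let [w] be a neighbour of [i], let [b] and [c] be the columns of [w] and [i]
    outside [{i, w}], and let [M] be the block outside [{i, w}], made invertible
    by the choice of its diagonal. With [a_ww = b^T M^-1 b], the Schur
    complement of [M] is [[*, d], [d, 0]] where [d = a_iw - c^T M^-1 b], and
    [d] is nonzero for [a_iw = 1] or [a_iw = 2]. *)

Set Implicit Arguments.
Unset Strict Implicit.
Unset Printing Implicit Defensive.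

Import Order.TTheory GRing.Theory Num.Theory.
Local Open Scope ring_scope.

(** * Invertible matrices and the SNIP *)

Lemma unitmx_SNIP (R : realType) (n : nat) (i : 'I_n) (A : 'M[R]_n) :
  A \in unitmx -> SNIP i A.
Proof.
move=> uA X symX _ diagX rowX.
pose u := invmx A *m delta_mx i (0 : 'I_1); pose v := row i (A *m X).
have AXE : A *m X = delta_mx i (0 : 'I_1) *m v.
  apply/matrixP=> j k; rewrite [RHS]mxE big_ord1 [v _ _]mxE.
  rewrite [delta_mx _ _ _ _]mxE eqxx andbT.
  have [->|] := eqVneq j i; first by rewrite mul1r.
  case: (unliftP i j) => [j' -> _|-> /eqP//]; rewrite mul0r.
  by move/matrixP/(_ j' k): rowX; rewrite mxE [RHS]mxE.
have XE j k : X j k = u j 0 * v 0 k.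
  by rewrite -(mulKmx uA X) AXE mulmxA -/u mxE big_ord1.
have Xd j : u j 0 * v 0 j = 0.
  by rewrite -XE; move/matrixP/(_ j j): diagX; rewrite !mxE eqxx mul1r.
have Xs j k : u j 0 * v 0 k = u k 0 * v 0 j.
  by rewrite -!XE -[in LHS]symX mxE.
(* Since [A *m u] is the [i]-th unit vector, some [u j 0] is nonzero. The zero diagonal then forces
   [v 0 j = 0], and the symmetry [Xs] carries this to every entry of [v]. *)
have [j uj0] : exists j, u j 0 != 0.
  apply/existsP; apply: contraT => /existsPn u0.
  have : A *m u = 0.
    suff -> : u = 0 by rewrite mulmx0.
    by apply/matrixP => j k; rewrite ord1 [RHS]mxE; apply/eqP/negbNE/u0.
  rewrite mulKVmx // => /matrixP/(_ i 0); rewrite !mxE !eqxx => /eqP.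
  by rewrite oner_eq0.
have vj0 : v 0 j = 0.
  by apply/eqP; move/eqP: (Xd j); rewrite mulf_eq0 (negPf uj0).
apply/matrixP => k l; rewrite XE [RHS]mxE.
have /eqP := Xs j l; rewrite vj0 mulr0 mulf_eq0 (negPf uj0) /= => /eqP ->.
by rewrite mulr0.
Qed.

(** * Rank and nullity after deletion of a row and a column *)

Lemma mxrank_row' (F : fieldType) (m n : nat) (i : 'I_m) (A : 'M[F]_(m, n)) :
  (\rank A <= (\rank (row' i A)).+1)%N.
Proof.
have sA : (A <= row i A + row' i A)%MS.
  apply/row_subP => k; case: (unliftP i k) => [j ->|->]; last exact: addsmxSl.
  apply: submx_trans (addsmxSr _ _).
  have -> : row (lift i j) A = row j (row' i A) by apply/rowP=> l; rewrite !mxE.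
  exact: row_sub.
apply: leq_trans (mxrankS sA) (leq_trans (mxrank_adds_leqif _ _) _).
by rewrite -[leqRHS]add1n leq_add2r rank_leq_row.
Qed.

Lemma nullity_principal_del_unitmx (R : realType) (n : nat) (i : 'I_n)
    (A : 'M[R]_n) :
  A \in unitmx -> invmx A i i = 0 -> nullity (principal_del A i) = 1%N.
Proof.
move=> uA; rewrite /invmx uA !mxE => /eqP; rewrite mulf_eq0 invr_eq0.
have := uA; rewrite unitmxE unitfE => /negPf -> /=.
(* The sign of the [(i, i)] cofactor is 1, so the vanishing entry of the inverse says that [A(i)]
   has determinant zero. *)
rewrite /cofactor addnn -signr_odd odd_double expr0 mul1r => /eqP detB.
rewrite /nullity mxrank_coker.
have lb : (n <= (\rank (principal_del A i)).+2)%N.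
  rewrite -{1}(mxrank_unit uA) -mxrank_tr.
  apply: leq_trans (mxrank_row' i _) _; rewrite ltnS -mxrank_tr.
  apply: leq_trans (mxrank_row' i _) _; rewrite ltnS.
  suff -> : row' i (row' i A^T)^T = principal_del A i by [].
  by apply/matrixP => j k; rewrite !mxE.
have ub : (\rank (principal_del A i) < n.-1)%N.
  rewrite ltn_neqAle rank_leq_row andbT; apply/negP => fB.
  have : principal_del A i \in unitmx by rewrite -row_free_unit.
  by rewrite unitmxE detB unitr0.
case: n => [[//]|n] in i A uA detB lb ub *.
apply/eqP; rewrite eqn_leq subn_gt0 ub andbT leq_subLR addn1.
by rewrite ltnS in lb.
Qed.

(** * An invertible shift by a nonzero scalar *)

Lemma exists_shift_unitmx (R : numFieldType) (n : nat) (N : 'M[R]_n) :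
  exists2 t : R, t != 0 & N - t%:M \in unitmx.
Proof.
(* A non-root [t] of [p] is nonzero, because of the factor ['X], and is not an eigenvalue of [N].
   One exists among the [size p] first naturals: they are distinct in characteristic zero, and [p]
   has fewer than [size p] roots. *)
pose p := 'X * char_poly N.
have p0 : p != 0 by rewrite mulf_neq0 ?polyX_eq0 ?monic_neq0 ?char_poly_monic.
pose s := [seq k%:R : R | k <- iota 0 (size p)].
have us : uniq s.
  by rewrite map_inj_uniq ?iota_uniq //; apply: mulrIn (oner_neq0 _).
have [/allP sp|/allPn[t _]] := boolP (all (root p) s).
  have := max_poly_roots p0 (introT allP sp) us.
  by rewrite size_map size_iota ltnn.
rewrite /root hornerM hornerX mulf_eq0 negb_or => /andP[t0 rt].
exists t => //; move: rt; rewrite -/(root _ _) -eigenvalue_root_char.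
by rewrite /eigenvalue negbK kermx_eq0 row_free_unit.
Qed.

(** * Dot products of column vectors *)

Section ColumnDotProduct.
Variables (R : comNzRingType) (n : nat).
Implicit Types u v x : 'cV[R]_n.

Definition dotc u v : R := (u^T *m v) 0 0.

Lemma dotcC u v : dotc u v = dotc v u.
Proof. by rewrite /dotc -[in LHS](trmxK v) -trmx_mul mxE. Qed.

Lemma dotcDl u v x : dotc (u + v) x = dotc u x + dotc v x.
Proof. by rewrite /dotc linearD /= mulmxDl mxE. Qed.

Lemma dotcZl a u x : dotc (a *: u) x = a * dotc u x.
Proof. by rewrite /dotc linearZ /= -scalemxAl mxE. Qed.

Lemma dotcBr u v x : dotc x (u - v) = dotc x u - dotc x v.
Proof. by rewrite /dotc mulmxBr !mxE. Qed.

Lemma dotc_delta i x : dotc (delta_mx i 0) x = x i 0.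
Proof. by rewrite /dotc trmx_delta -rowE mxE. Qed.

Lemma outer_mulmx u v x : u *m v^T *m x = dotc v x *: u.
Proof. by rewrite -mulmxA [v^T *m x]mx11_scalar mul_mx_scalar. Qed.

Lemma dotc_mulmx (A : 'M[R]_n) u v :
  A^T = A -> dotc u (A *m v) = dotc (A *m u) v.
Proof. by move=> sA; rewrite /dotc trmx_mul sA mulmxA. Qed.

End ColumnDotProduct.

(** * The bordered matrix *)

Section Bordered.
Variables (R : realType) (n : nat) (G : simple_graph n) (i w : 'I_n).
Hypothesis Giw : G i w.
Variable t : R.
Hypothesis t0 : t != 0.

Let off (j : 'I_n) := (j != i) && (j != w).

(** Padding with zeros at [i] and [w] keeps the size [n]: [M] is then the block outside [{i, w}]
    together with [-t] at the two remaining diagonal places. *)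
Definition outer_adj : 'M[R]_n := \matrix_(j, k) ((off j && off k && G j k)%:R).
Definition outer_col (l : 'I_n) : 'cV[R]_n := \col_j (off j && G j l)%:R.

Let M := outer_adj - t%:M.
Hypothesis uM : M \in unitmx.

Let b := outer_col w.
Let c := outer_col i.
Let ei : 'cV[R]_n := delta_mx i 0.
Let ew : 'cV[R]_n := delta_mx w 0.
Let z := invmx M *m b.
Let q := invmx M *m c.

(** The terms [t *: ei] and [t *: ew] cancel the entries [-t] of [M] at [i] and [w]; [s] is the
    entry [a_iw]. Writing the border as rank-one terms reduces products with a vector to dot
    products. *)
Definition bordered (s : R) : 'M[R]_n :=
  M + ei *m (t *: ei + s *: ew + c)^T
    + ew *m (s *: ei + (t + dotc b z) *: ew + b)^T
    + b *m ew^T + c *m ei^T.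

Let wi : (w == i) = false.
Proof. by apply: contraTF Giw => /eqP ->; rewrite adj_irr. Qed.

Let iw : (i == w) = false. Proof. by rewrite eq_sym wi. Qed.

Lemma borderedE s j k : bordered s j k =
  if j == k then (if j == i then 0 else if j == w then dotc b z else - t)
  else if (j == i) && (k == w) || (j == w) && (k == i) then s
  else (G j k)%:R.
Proof.
rewrite /bordered !mxE !big_ord1 !mxE !eqxx !andbT /off.
have [->|jk] := eqVneq j k.
  have [->|ki] := eqVneq k i; first by rewrite iw /=; ring.
  by have [->|kw] := eqVneq k w; rewrite ?adj_irr ?andbF /=; ring.
have [ji|ji] := eqVneq j i.
  rewrite ji in jk *; rewrite iw (eq_sym k) (negPf jk) (adj_sym G i).
  by have [->|kw] := eqVneq k w; rewrite ?(adj_sym G w) ?Giw /=; ring.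
have [jw|jw] := eqVneq j w.
  rewrite jw in jk *; rewrite [k == w]eq_sym (negPf jk) (adj_sym G w).
  by have [->|ki] := eqVneq k i; rewrite ?Giw /=; ring.
have [->|ki] := eqVneq k i; first by rewrite iw /=; ring.
by have [->|kw] := eqVneq k w; rewrite /=; ring.
Qed.

Lemma bordered_in_S s : s != 0 -> in_S G (bordered s).
Proof.
move=> s0; split=> [|j k jk].
  apply/matrixP => j k; rewrite mxE !borderedE (eq_sym k j).
  have [->//|jk] := eqVneq j k.
  by rewrite (adj_sym G k j) orbC [in LHS]andbC [(k == i) && _]andbC.
rewrite borderedE (negPf jk); case: ifP => [|_].
  by case/orP=> /andP[/eqP-> /eqP->]; rewrite s0 ?Giw // adj_sym Giw.
by case: (G j k); rewrite ?oner_neq0 ?eqxx.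
Qed.

Lemma bordered_mul s x : bordered s *m x =
  M *m x + (t * x i 0 + s * x w 0 + dotc c x) *: ei
    + (s * x i 0 + (t + dotc b z) * x w 0 + dotc b x) *: ew
    + x w 0 *: b + x i 0 *: c.
Proof.
by rewrite /bordered !mulmxDl !outer_mulmx !dotcDl !dotcZl !dotc_delta.
Qed.

Let M_row j (x : 'cV_n) : off j = false -> (M *m x) j 0 = - t * x j 0.
Proof.
move=> oj; rewrite mulmxBl mul_scalar_mx !mxE big1 ?add0r ?mulNr // => k _.
by rewrite mxE oj mul0r.
Qed.

Let offi : off i = false. Proof. by rewrite /off eqxx. Qed.
Let offw : off w = false. Proof. by rewrite /off eqxx andbF. Qed.

Let col0 j l : off j = false -> outer_col l j 0 = 0.
Proof. by rewrite mxE => ->. Qed.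

Let sol0 j l : off j = false -> (invmx M *m outer_col l) j 0 = 0.
Proof.
move=> oj; have /eqP := M_row (invmx M *m outer_col l) oj.
by rewrite mulKVmx // col0 // eq_sym mulf_eq0 oppr_eq0 (negPf t0) => /eqP.
Qed.

Let symM : M^T = M.
Proof.
apply/matrixP => j k; rewrite !mxE (adj_sym G k) [off k && _]andbC.
by rewrite eq_sym.
Qed.

Let dot_bq : dotc b q = dotc c z.
Proof.
by rewrite dotcC -[in LHS](mulKVmx uM b) dotc_mulmx // /q mulKVmx.
Qed.

Let M_delta j : off j = false ->
  M *m delta_mx j 0 = - t *: (delta_mx j 0 : 'cV_n).
Proof.
move=> oj; rewrite mulmxBl mul_scalar_mx scaleNr -colE.
suff -> : col j outer_adj = 0 by rewrite add0r.
by apply/colP=> k; rewrite !mxE oj andbF.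
Qed.

(** Subtracting [z] cancels [b], and the choice of the [(w, w)] entry cancels the coordinate [w]. As
    [ew - z] vanishes at [i], so does column [i] of the inverse, a multiple of it. *)
Lemma bordered_kernel_i s : bordered s *m (ew - z) = (s - dotc c z) *: ei.
Proof.
have E k : off k = false -> (ew - z) k 0 = (k == w)%:R.
  move=> ok; rewrite [LHS]mxE [(- z) _ _]mxE sol0 //.
  by rewrite oppr0 addr0 mxE eqxx andbT.
rewrite bordered_mul !E // iw eqxx mulmxBr M_delta // mulKVmx //.
rewrite !dotcBr !(dotcC _ ew) !dotc_delta !col0 //.
by apply/colP=> k; rewrite !mxE !mulr1n !mulr0n; ring.
Qed.

(** Together with [bordered_kernel_i], this puts [ei] and [ew] in the range once [s] differs from
    [dotc c z]. *)
Lemma bordered_kernel_w s :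
  bordered s *m (ei - q) = - dotc c q *: ei + (s - dotc c z) *: ew.
Proof.
have E k : off k = false -> (ei - q) k 0 = (k == i)%:R.
  move=> ok; rewrite [LHS]mxE [(- q) _ _]mxE sol0 //.
  by rewrite oppr0 addr0 mxE eqxx andbT.
rewrite bordered_mul !E // wi eqxx mulmxBr M_delta // mulKVmx //.
rewrite !dotcBr !(dotcC _ ei) !dotc_delta !col0 // dot_bq.
by apply/colP=> k; rewrite !mxE !mulr1n !mulr0n; ring.
Qed.

Lemma bordered_unitmx s : s != 0 -> s != dotc c z -> bordered s \in unitmx.
Proof.
move=> s0 sd; have [symA _] := bordered_in_S s0.
have d0 : s - dotc c z != 0 by rewrite subr_eq0.
rewrite unitmxE unitfE; apply/det0P => -[x' x'0 /(congr1 trmx)].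
rewrite trmx_mul symA trmx0; set x := x'^T => Ax.
(* By symmetry, a kernel vector [x] is orthogonal to the range, hence to [ei] and [ew]. *)
have dot0 v : dotc (bordered s *m v) x = 0.
  by rewrite -dotc_mulmx // Ax /dotc mulmx0 mxE.
have xi : x i 0 = 0.
  have /eqP := dot0 (ew - z).
  by rewrite bordered_kernel_i dotcZl dotc_delta mulf_eq0 (negPf d0) => /eqP.
have xw : x w 0 = 0.
  have /eqP := dot0 (ei - q).
  rewrite bordered_kernel_w dotcDl !dotcZl !dotc_delta xi mulr0 add0r.
  by rewrite mulf_eq0 (negPf d0) => /eqP.
move: Ax; rewrite bordered_mul xi xw !mulr0 !add0r !scale0r !addr0 => Ax.
(* Coordinates [i] and [w] of [M *m x] are [-t] times those of [x], hence zero, so both remaining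
   border coefficients vanish and [M *m x = 0]. *)
have cx : dotc c x = 0.
  move/colP/(_ i): (Ax).
  rewrite [LHS]mxE [(M *m x + _) _ _]mxE M_row // xi mulr0.
  by rewrite !mxE !eqxx iw mulr1 mulr0 addr0 add0r.
have bx : dotc b x = 0.
  move/colP/(_ w): (Ax).
  rewrite [LHS]mxE [(M *m x + _) _ _]mxE M_row // xw mulr0.
  by rewrite !mxE !eqxx wi mulr1 mulr0 !add0r.
move: Ax; rewrite cx bx !scale0r !addr0 => Mx.
have x0 : x = 0 by rewrite -(mulKmx uM x) Mx mulmx0.
by case/eqP: x'0; rewrite -(trmxK x') -/x x0 trmx0.
Qed.

Lemma bordered_inv_ii s : s != 0 -> s != dotc c z -> invmx (bordered s) i i = 0.
Proof.
move=> s0 sd; have d0 : s - dotc c z != 0 by rewrite subr_eq0.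
have := congr1 (fun v => (invmx (bordered s) *m v) i 0) (bordered_kernel_i s).
rewrite mulKmx ?bordered_unitmx // -scalemxAr -colE.
rewrite [LHS]mxE [(- z) _ _]mxE sol0 // !mxE iw oppr0 addr0 => /esym/eqP.
by rewrite mulf_eq0 (negPf d0) => /eqP.
Qed.

Lemma bordered_allows : allows_with_SNIP R G i 0 1.
Proof.
have [s s0 sd] : exists2 s : R, s != 0 & s != dotc c z.
  have [E|] := eqVneq (dotc c z) 1.
    by exists 2%:R; rewrite ?E ?pnatr_eq0 ?pnatr_eq1.
  by exists 1; rewrite ?oner_neq0 1?eq_sym.
have uA := bordered_unitmx s0 sd.
exists (bordered s); split; [exact: bordered_in_S | exact: unitmx_SNIP |].
rewrite (nullity_principal_del_unitmx uA (bordered_inv_ii s0 sd)).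
by rewrite /nullity mxrank_coker mxrank_unit // subnn.
Qed.

End Bordered.

Theorem proposition4p2 (R : realType) (n : nat) (G : simple_graph n)
    (i : 'I_n) (hi : ~ isolated G i) :
  allows_with_SNIP R G i 0 1.
Proof.
have [w Giw] : exists w, G i w.
  by apply/existsP; apply: contraT => /existsPn.
have [t t0 uM] := exists_shift_unitmx (outer_adj R G i w).
exact: (bordered_allows Giw t0 uM).
Qed.
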